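(* There exist exactly $2^{\mathfrak{c}}$ distinct ultrafilter orders on the Knaster continuum, where $\mathfrak{c}=2^{\aleph_0}$.
   Context: A continuum is a compact connected metrizable space; fix a metric generating its topology. A chain in $X$ is a finite sequence of open sets $d_1,\dots,d_k$ (its links) with $d_i\cap d_j\neq\varnothing\iff|i-j|\le 1$; its mesh is the maximum of the diameters of its links. $X$ is chainable if for every $\varepsilon>0$ it is covered by a chain of mesh less than $\varepsilon$. $\mathbb{N}=\{1,2,3,\dots\}$. Let $\mathcal{D}=\{D_n\}_{n\in\mathbb{N}}$ be a sequence of chains $D_n=\{d_{1,n},\dots,d_{k_n,n}\}$, each covering $X$, with $\mathrm{mesh}(D_n)\to 0$, and let $\mathcal{U}$ be a non-principal ultrafilter on $\mathbb{N}$. Write $x\leq_{D_n}y$ iff there exist $i\le j\le k_n$ with $x\in d_{i,n}$ and $y\in d_{j,n}$, and $x\leq_{\mathcal{U}}^{\mathcal{D}}y$ iff $\{n\in\mathbb{N}: x\leq_{D_n}y\}\in\mathcal{U}$. This is a linear order on $X$. An ultrafilter order on $X$ is any order of the form $\leq_{\mathcal{U}}^{\mathcal{D}}$ for some such $\mathcal{D}$ and $\mathcal{U}$ (both are allowed to vary); two ultrafilter orders are distinct if they are different as relations on $X$. Let $\mathcal{C}\subseteq[0,1]\times\{0\}$ be the standard Cantor ternary set. The Knaster continuum is the (chainable) subspace $K$ of $\mathbb{R}^2$ consisting of: all semicircles with ordinates $\ge0$, with center $(\frac12,0)$, passing through points of $\mathcal{C}$; and, for each $n\ge1$, all semicircles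 with ordinates $\le0$, with center $(\frac{5}{2\cdot3^n},0)$, passing through points of $\mathcal{C}$ lying in the interval $[\frac{2}{3^n},\frac{1}{3^{n-1}}]$. Equivalently (up to homeomorphism), it is the inverse limit $\varprojlim(I_i,f_i)_{i=1}^\infty$ with $I_i=[0,1]$ and $f_i=f$, where $f(t)=2t$ for $t\in[0,\frac12]$ and $f(t)=2-2t$ for $t\in[\frac12,1]$. *)

(* Defs.v *)
From mathcomp Require Export all_boot all_order all_algebra.
From mathcomp Require Export all_classical all_reals all_analysis.
Export Order.TTheory GRing.Theory Num.Theory.
Export numFieldNormedType.Exports.

Set Implicit Arguments.
Unset Strict Implicit.
Unset Printing Implicit Defensive.

Local Open Scope classical_set_scope.
Local Open Scope ring_scope.

(* A space is a subset X of a normed space V, with the subspace topology and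
   the metric induced by the norm.  For compact X the notion of ultrafilter
   order does not depend on which metric generating the topology is used. *)

Definition rel_open (R : realType) (V : normedModType R) (X d : set V) : Prop :=
  exists2 U : set V, open U & d = X `&` U.

Definition diam (R : realType) (V : normedModType R) (d : set V) : \bar R :=
  ereal_sup [set `|p.1 - p.2|%:E | p in d `*` d].

(* A chain is the sequence of its links, indexed from 0: the link d_{i+1} is
   [link D i]. *)
Definition link (V : Type) (D : seq (set V)) (i : nat) : set V := nth set0 D i.

(* Taking i = j, the intersection condition says that the links are
   nonempty. *)
Definition is_chain (R : realType) (V : normedModType R) (X : set V)
    (D : seq (set V)) : Prop :=
  (forall i, (i < size D)%N -> rel_open X (link D i)) /\
  (forall i j, (i < size D)%N -> (j < size D)%N ->
     (link D i `&` link D j !=set0 <-> (i <= j.+1)%N /\ (j <= i.+1)%N)).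

(* The default value 0 only matters for the chain without links. *)
Definition mesh (R : realType) (V : normedModType R) (D : seq (set V)) :
  \bar R := \big[maxe/0%E]_(d <- D) diam d.

Definition covers (V : Type) (X : set V) (D : seq (set V)) : Prop :=
  X `<=` \bigcup_(i in `I_(size D)) link D i.

Definition chain_le (V : Type) (D : seq (set V)) (x y : V) : Prop :=
  exists i j : nat,
    [/\ (i <= j)%N, (j < size D)%N, link D i x & link D j y].

Definition nonprincipal_ultrafilter (T : Type) (U : set_system T) : Prop :=
  UltraFilter U /\ forall t : T, U <> principal_filter t.

Definition chain_sequence (R : realType) (V : normedModType R) (X : set V)
    (D : nat -> seq (set V)) : Prop :=
  (forall n, is_chain X (D n) /\ covers X (D n)) /\
  mesh (D n) @[n --> \oo] --> 0%E.

Definition ultra_le (V : Type) (X : set V) (D : nat -> seq (set V))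
    (U : set_system nat) : set (V * V) :=
  [set p | [/\ X p.1, X p.2 & U [set n | chain_le (D n) p.1 p.2]]].

Definition ultrafilter_order (R : realType) (V : normedModType R) (X : set V)
    (L : set (V * V)) : Prop :=
  exists (D : nat -> seq (set V)) (U : set_system nat),
    [/\ chain_sequence X D, nonprincipal_ultrafilter U & L = ultra_le X D U].

Definition cantor_step (R : realType) (A : set R) : set R :=
  [set x / 3 | x in A] `|` [set (x + 2) / 3 | x in A].

Definition ternary_cantor (R : realType) : set R :=
  \bigcap_n iter n (@cantor_step R) `[0, 1]%classic.

(* The semicircles with center (a, 0) through (c, 0). *)
Definition upper_semicircle (R : realType) (a c : R) : set (R * R) :=
  [set p | (p.1 - a) ^+ 2 + p.2 ^+ 2 = (c - a) ^+ 2 /\ 0 <= p.2].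

Definition lower_semicircle (R : realType) (a c : R) : set (R * R) :=
  [set p | (p.1 - a) ^+ 2 + p.2 ^+ 2 = (c - a) ^+ 2 /\ p.2 <= 0].

Definition knaster (R : realType) : set (R * R) :=
  (\bigcup_(c in @ternary_cantor R) upper_semicircle (1 / 2) c) `|`
  (\bigcup_(n in [set n : nat | (1 <= n)%N])
    \bigcup_(c in @ternary_cantor R `&` `[2 / 3 ^+ n, 1 / 3 ^+ n.-1]%classic)
      lower_semicircle (5 / (2 * 3 ^+ n)) c).

(* Main.v *)
Require Import Defs.
From mathcomp Require Import ring lra zify.

(** A binary relation on the plane is a set of quadruples of reals, and
quadruples of reals are coded by sets of natural numbers ([code_inj]), so there
are at most as many orders as sets of sets of natural numbers.

For the converse, one sequence of chains is enough, and the ultrafilter varies.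
In the inverse limit of tent maps the coordinates of a point are subject to one
constraint only: each is an image of the next under a map which is two to one.
So a point can be chosen with coordinates that are small or large in any
prescribed pattern. If two points have complementary patterns, and the [n]-th
chain consists of preimages of short intervals under the [n]-th coordinate, then
the set of the [n] for which the first point is below the second one is an
arbitrary prescribed set of indices ([knaster_chains]). Whether the ultrafilter
contains this set can be read off from the order; hence the order determines
the ultrafilter, and it remains to recall that there are as many non-principal
ultrafilters as sets of sets of natural numbers ([many_ultrafilters]).

The continuum is given here as a union of semicircles, and the inverse limit
structure has to be found in it. It is carried by the map [shift], which on the
continuum is a bijection given by an explicit formula ([knaster_shift],
[shift_onto], [unshiftP]); the coordinates are the iterates of [shift] followed
by the angle [pos]. The inverse of [shift] contracts the fibres of the
coordinates by the factor 3 ([coord_fiber]). Since the continuum is compact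
([compact_knaster]), preimages of short intervals are then small
([chain_of_function]), which gives chains of small mesh. *)

Set Implicit Arguments.
Unset Strict Implicit.
Unset Printing Implicit Defensive.

Local Open Scope classical_set_scope.
Local Open Scope card_scope.

(** * The Cantor set *)

Section Cantor.
Context {R : realType}.
Local Open Scope ring_scope.
Implicit Types x y c t : R.
Local Notation C := (@ternary_cantor R).
Local Notation stage n := (iter n (@cantor_step R) `[0, 1]%classic).

Lemma cantor_stage01 n x : stage n x -> 0 <= x <= 1.
Proof.
elim: n x => [|n IH] x /=; first by rewrite in_itv.
by case=> -[y /IH y01 <-]; lra.
Qed.

Lemma cantor01 x : C x -> 0 <= x <= 1.
Proof. by move=> /(_ 0%N I); exact: (@cantor_stage01 0). Qed.

Lemma cantor_third x : C x -> C (x / 3).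
Proof.
move=> Cx [|n] _ /=.
  by have := cantor01 Cx; rewrite in_itv /=; lra.
by left; exists x => //; exact: Cx.
Qed.

Lemma cantor_compl x : C x -> C (1 - x).
Proof.
move=> Cx n _; have {Cx} := Cx n I.
elim: n x => [|n IH] x /=; first by rewrite !in_itv /=; lra.
case=> -[y /IH Cy <-].
- by right; exists (1 - y) => //; lra.
- by left; exists (1 - y) => //; lra.
Qed.

Lemma cantor0 : C 0.
Proof.
move=> n _; elim: n => [|n IH] /=; first by rewrite in_itv /= lexx ler01.
by left; exists 0; rewrite // mul0r.
Qed.

(** The first ternary digit of [x] is [0] or [2]; at each stage the same one,
because the other third would put the preimage outside the unit interval. *)
Lemma cantorP x : C x -> C (3 * x) \/ C (3 * x - 2).
Proof.
move=> Cx; have [x2|x2] := leP x (1 / 2).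
- left=> n _; have [[y Cy xE]|[y Cy xE]] := Cx n.+1 I.
  + by rewrite (_ : 3 * x = y) //; lra.
  + by have := cantor_stage01 Cy; lra.
- right=> n _; have [[y Cy xE]|[y Cy xE]] := Cx n.+1 I.
  + by have := cantor_stage01 Cy; lra.
  + by rewrite (_ : 3 * x - 2 = y) //; lra.
Qed.

Lemma cantor_gap x : C x -> x <= 1 / 3 \/ 2 / 3 <= x.
Proof. by case/cantorP => /cantor01; lra. Qed.

Lemma cantor_left x : C x -> x <= 1 / 2 -> C (3 * x).
Proof. by move=> /cantorP[//|/cantor01]; lra. Qed.

Lemma cantor_right x : C x -> 1 / 2 <= x -> C (3 * x - 2).
Proof. by move=> /cantorP[/cantor01|//]; lra. Qed.

Lemma closed_cantor : closed C.
Proof.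
apply: closed_bigI => n _; apply: compact_closed; first exact: Rhausdorff.
elim: n => [|n IH] /=; first exact: segment_compact.
apply: compactU; apply: continuous_compact => //;
  apply: continuous_subspaceT => x; apply: cvgM; try exact: cvg_cst.
  exact: cvg_id.
by apply: cvgD; [exact: cvg_id|exact: cvg_cst].
Qed.

End Cantor.

(** * Semicircles and self-similarity of the Knaster continuum *)

Section Knaster.
Context {R : realType}.
Local Open Scope ring_scope.
Implicit Types (x y r u v : R) (p q : R * R).
Local Notation C := (@ternary_cantor R).
Local Notation K := (@knaster R).

(** The radii of the upper semicircles; thrice those of the rightmost lower
ones. *)
Definition radius r := C (1 / 2 - r) /\ 0 < r.

(** The angle on a semicircle is recorded by its cosine, so that the shift map
below acts on it by affine maps. *)
Definition up r u : R * R := (1 / 2 + r * u, r * Num.sqrt (1 - u ^+ 2)).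

Definition low r v : R * R :=
  (5 / 6 + r * v / 3, - (r * Num.sqrt (1 - v ^+ 2) / 3)).

Definition scale (a : R) p : R * R := (a * p.1, a * p.2).

Lemma radius_bounds r : radius r -> 1 / 6 <= r <= 1 / 2.
Proof. by case=> Cr r0; have := cantor01 Cr; have := cantor_gap Cr; lra. Qed.

Lemma radius_dist c : C c -> radius `|c - 1 / 2|.
Proof.
move=> Cc; split; last by rewrite normr_gt0; case: (cantor_gap Cc) => ?; apply/eqP; lra.
have [c2|c2] := leP (1 / 2) c.
  rewrite ger0_norm; last by lra.
  by rewrite (_ : 1 / 2 - _ = 1 - c); [exact: cantor_compl|lra].
by rewrite ltr0_norm; [rewrite (_ : 1 / 2 - _ = c)//; lra|lra].
Qed.

Lemma sqr_le_bounds (a b : R) : 0 <= b -> (a ^+ 2 <= b ^+ 2) = (- b <= a <= b).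
Proof.
by move=> b0; rewrite -ler_norml -[a ^+ 2]real_normK ?num_real// ler_pXn2r ?nnegrE.
Qed.

Lemma polar x y r : 0 < r -> x ^+ 2 + y ^+ 2 = r ^+ 2 ->
  exists u, [/\ -1 <= u <= 1, x = r * u & `|y| = r * Num.sqrt (1 - u ^+ 2)].
Proof.
move=> r0 xyr; have r1 : r != 0 by rewrite gt_eqF.
have ru : r * (x / r) = x by rewrite mulrC divfK.
have u1 : (x / r) ^+ 2 <= 1.
  rewrite exprMn exprVn ler_pdivrMr ?exprn_gt0// mul1r -xyr.
  by rewrite lerDl sqr_ge0.
exists (x / r); split=> //.
  by rewrite -ler_norml -(@ler_pXn2r _ 2)// ?nnegrE// expr1n real_normK ?num_real.
rewrite -sqrtr_sqr; transitivity (Num.sqrt (r ^+ 2 * (1 - (x / r) ^+ 2))).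
  by congr Num.sqrt; rewrite mulrBr mulr1 -exprMn ru -xyr; ring.
by rewrite sqrtrM ?sqr_ge0// sqrtr_sqr ger0_norm// ltW.
Qed.

Lemma sqr_sin u : -1 <= u <= 1 -> Num.sqrt (1 - u ^+ 2) ^+ 2 = 1 - u ^+ 2.
Proof.
by move=> u1; rewrite sqr_sqrtr// subr_ge0 -[leRHS](expr1n _ 2) sqr_le_bounds.
Qed.

Lemma knaster_up r u : radius r -> -1 <= u <= 1 -> K (up r u).
Proof.
case=> Cr r0 u1; left; exists (1 / 2 - r) => //; split=> /=; last first.
  by rewrite mulr_ge0 ?sqrtr_ge0// ltW.
by rewrite [X in _ + X]exprMn sqr_sin//; ring.
Qed.

Lemma knaster_low r v : radius r -> -1 <= v <= 1 -> K (low r v).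
Proof.
move=> rr u1; have r6 := radius_bounds rr; case: rr => Cr r0.
right; exists 1%N => //=; exists ((1 / 2 - r + 2) / 3).
  split; last by rewrite /= expr0 expr1 in_itv/=; have := cantor01 Cr; lra.
  move=> [_|n _]; first by rewrite /= in_itv /=; lra.
  by right; exists (1 / 2 - r) => //; exact: Cr.
split=> /=; last by rewrite oppr_le0 !mulr_ge0 ?sqrtr_ge0 ?invr_ge0 //; lra.
rewrite sqrrN [X in _ + X]expr_div_n exprMn sqr_sin// expr1; by field.
Qed.

Lemma knaster_scale p : K p -> p.2 <= 0 -> K (scale (1 / 3) p).
Proof.
case=> [[c Cc [cp p0] p2]|[n /= n1 [c [Cc]]]].
  have {}p2 : p.2 = 0 by lra.
  have {}cp : p.1 = c \/ p.1 = 1 - c.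
    have : (p.1 - c) * (p.1 - (1 - c)) = 0 by move: cp; rewrite p2; nra.
    by move/eqP; rewrite mulf_eq0 => /orP[] /eqP; lra.
  left; exists (p.1 / 3).
    by apply: cantor_third; case: cp => ->//; exact: cantor_compl.
  by rewrite /scale/= p2; split=> /=; [field|rewrite mulr0].
rewrite /= in_itv/= => /andP[c2 c3] [cp p2] _.
right; exists n.+1 => //; exists (c / 3).
  split; first exact: cantor_third.
  rewrite /= in_itv/=; case: n n1 c2 c3 {cp} => [//|n _ /=].
  have p0 : 3 ^+ n != 0 :> R by rewrite expf_neq0.
  rewrite !exprS => c2 c3; apply/andP; split.
    rewrite [leLHS](_ : _ = 2 / (3 * 3 ^+ n) / 3); last by field.
    by rewrite ler_pM2r// invr_gt0.
  rewrite [leRHS](_ : _ = 1 / 3 ^+ n / 3); last by field.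
  by rewrite ler_pM2r// invr_gt0.
split=> /=; last by lra.
have p0 : 3 ^+ n != 0 :> R by rewrite expf_neq0.
rewrite [LHS](_ : _ = ((p.1 - 5 / (2 * 3 ^+ n)) ^+ 2 + p.2 ^+ 2) / 9).
  by rewrite cp [3 ^+ n.+1]exprS; field.
by rewrite [3 ^+ n.+1]exprS; field.
Qed.

(** The self-similarity that drives everything: below the axis, all but the
rightmost family of semicircles is a copy, shrunk by the factor 3, of the part
below the axis. *)
Lemma knasterP p : K p ->
  [\/ exists r u, [/\ radius r, -1 <= u <= 1 & p = up r u],
      exists r v, [/\ radius r, -1 <= v <= 1 & p = low r v] |
      exists q, [/\ K q, 0 <= q.1 <= 1, q.2 <= 0 & p = scale (1 / 3) q]].
Proof.
case: p => px py.
case=> [[c Cc [/= cp p0]]|[[//|n] /= _ [c [Cc]]]].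
  have [_ r0] := radius_dist Cc; rewrite -[RHS]real_normK ?num_real// in cp.
  have [u [u1 xE yE]] := polar r0 cp.
  apply: Or31; exists `|c - 1 / 2|, u; split=> //; first exact: radius_dist.
  by rewrite /up -yE -xE ger0_norm//; congr pair; lra.
rewrite /= in_itv/= => /andP[c2 c3] [/= cp p2].
case: n => [|n] in c2 c3 cp *.
  rewrite expr0 expr1 in c2 c3 cp.
  have Cd : C (3 * c - 2) by apply: cantor_right => //; lra.
  have rd := radius_dist Cd; have [_ r0] := rd.
  have {}cp : (3 * px - 5 / 2) ^+ 2 + (3 * py) ^+ 2 = `|3 * c - 2 - 1 / 2| ^+ 2.
    rewrite real_normK ?num_real//.
    by transitivity (9 * ((px - 5 / (2 * 3)) ^+ 2 + py ^+ 2)); [field|rewrite cp; field].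
  have [u [u1 xE yE]] := polar r0 cp.
  apply: Or32; exists `|3 * c - 2 - 1 / 2|, u; split=> //.
  by rewrite /low -yE -xE ler0_norm; [congr pair; lra|lra].
have wp : 0 < 3 ^+ n :> R by rewrite exprn_gt0.
have w0 : 3 ^+ n != 0 :> R by rewrite gt_eqF.
pose w : R := (3 ^+ n)^-1; have {wp}wp : 0 < w by rewrite invr_gt0.
have w1 : w <= 1 by rewrite invf_le1 ?exprn_gt0// exprn_ege1// ler1n.
have c2E : 2 / 3 ^+ n.+2 = 2 * w / 9 by rewrite !exprS /w; field.
have c3E : 1 / 3 ^+ n.+1 = w / 3 by rewrite !exprS /w; field.
have c5E : 5 / (2 * 3 ^+ n.+2) = 5 * w / 18 by rewrite !exprS /w; field.
rewrite c2E in c2; rewrite c3E in c3; rewrite c5E in cp.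
apply: Or33; exists (scale 3 (px, py)); split=> /=; last 2 first.
- by lra.
- by rewrite /scale /=; congr pair; field.
- right; exists n.+1 => //=; exists (3 * c).
    split; first by apply: cantor_left => //; lra.
    rewrite /= in_itv/=; apply/andP; split.
      by rewrite [leLHS](_ : _ = 2 * w / 3); [lra|rewrite !exprS /w; field].
    by rewrite [leRHS](_ : _ = w); [lra|rewrite /w; field].
  split=> /=; last by lra.
  rewrite [5 / _](_ : _ = 5 * w / 6); last by rewrite !exprS /w; field.
  transitivity (9 * ((px - 5 * w / 18) ^+ 2 + py ^+ 2)); first by field.
  by rewrite cp; field.
- have w18 : 0 <= w / 18 by lra.
  have : (px - 5 * w / 18) ^+ 2 <= (w / 18) ^+ 2.
    apply: (@le_trans _ _ ((c - 5 * w / 18) ^+ 2)); first by rewrite -cp lerDl sqr_ge0.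
    by rewrite sqr_le_bounds//; lra.
  by rewrite sqr_le_bounds//; lra.
Qed.
End Knaster.

(** * The shift map and the coordinates *)

Section Shift.
Context {R : realType}.
Local Open Scope ring_scope.
Implicit Types (x y r u v : R) (p q : R * R).
Local Notation C := (@ternary_cantor R).
Local Notation K := (@knaster R).

Definition rad p : R := Num.sqrt ((p.1 - 1 / 2) ^+ 2 + Num.max p.2 0 ^+ 2).

(** On the continuum this is the cosine of the angle above the axis, and the
sign of [x - 1 / 2] below it, since there [rad p] is [`|x - 1 / 2|]. The bound
[1 / 6] bounds every radius from below and serves to make the quotient continuous
on the whole plane. *)
Definition pos p : R := (p.1 - 1 / 2) / Num.max (rad p) (1 / 6).

(** In the description of the continuum as an inverse limit of tent maps, this
is the shift homeomorphism. It stretches each path made of an upper semicircle,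
a rightmost lower one and an upper one again to a single upper semicircle, each
piece covering one third of the cosines, and enlarges the other lower
semicircles by the factor 3. A single formula, continuous on the plane, does
both: below the axis [pos p] is [1] or [-1], so that the weights
[(1 + pos p) / 2] and [(1 - pos p) / 2] select the branch, while above the axis
[m] vanishes and both branches agree. *)
Definition shift p : R * R :=
  let h := `|rad p - 1 / 3| * Num.sqrt (9 - (pos p - 2) ^+ 2) in
  let m := Num.min p.2 0 in
  (1 / 2 + (rad p - 1 / 3) * (pos p - 2),
   (1 + pos p) / 2 * Num.sqrt (h ^+ 2 + 9 * m ^+ 2) +
   (1 - pos p) / 2 * (h + 3 * m)).

Lemma up_ge0 r u : radius r -> 0 <= (up r u).2.
Proof. by case=> _ r0; rewrite mulr_ge0 ?sqrtr_ge0// ltW. Qed.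

Lemma low_le0 r v : radius r -> (low r v).2 <= 0.
Proof. by case=> _ r0; rewrite oppr_le0 !mulr_ge0 ?sqrtr_ge0 ?invr_ge0// ltW. Qed.

Lemma sin_le1 u : Num.sqrt (1 - u ^+ 2) <= 1.
Proof. by rewrite -[leRHS]sqrtr1 ler_wsqrtr// lerBlDr lerDl sqr_ge0. Qed.

Lemma rad_up r u : radius r -> -1 <= u <= 1 -> rad (up r u) = r.
Proof.
move=> rr u1; have y0 := up_ge0 u rr; case: rr => _ r0.
rewrite /rad max_l//= [X in _ + X]exprMn sqr_sin//.
rewrite [X in Num.sqrt X](_ : _ = r ^+ 2); last by ring.
by rewrite sqrtr_sqr ger0_norm// ltW.
Qed.

Lemma pos_up r u : radius r -> -1 <= u <= 1 -> pos (up r u) = u.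
Proof.
move=> rr u1; rewrite /pos rad_up//= max_l; last by have := radius_bounds rr; lra.
by case: rr => _ r0; field; rewrite gt_eqF.
Qed.

Lemma up_inj r u r' u' : radius r -> -1 <= u <= 1 -> radius r' -> -1 <= u' <= 1 ->
  up r u = up r' u' -> r = r' /\ u = u'.
Proof.
move=> rr u1 rr' u1' e.
by split; [rewrite -(rad_up rr u1) e rad_up|rewrite -(pos_up rr u1) e pos_up].
Qed.

Lemma rad_le0 p : p.2 <= 0 -> rad p = `|p.1 - 1 / 2|.
Proof. by move=> y0; rewrite /rad max_r// expr0n addr0 sqrtr_sqr. Qed.

Lemma pos_right p : p.2 <= 0 -> 2 / 3 <= p.1 -> pos p = 1.
Proof.
move=> y0 x3; rewrite /pos rad_le0// max_l ger0_norm; try lra.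
by rewrite divff//; apply/eqP; lra.
Qed.

Lemma pos_left p : p.2 <= 0 -> p.1 <= 1 / 3 -> pos p = -1.
Proof.
move=> y0 x3; rewrite /pos rad_le0// max_l ler0_norm; try lra.
by rewrite invrN mulrN divff//; apply/eqP; lra.
Qed.

Lemma shift_up r u : radius r -> -1 <= u <= 1 ->
  shift (up r u) = (1 / 2 + (r - 1 / 3) * (u - 2), 
    `|r - 1 / 3| * Num.sqrt (9 - (u - 2) ^+ 2)).
Proof.
move=> rr u1; rewrite /shift rad_up// pos_up// min_r; last exact: up_ge0.
rewrite expr0n !mulr0 !addr0; set h := `|_| * _.
have h0 : 0 <= h by rewrite mulr_ge0 ?sqrtr_ge0.
by rewrite sqrtr_sqr ger0_norm//; congr pair; field.
Qed.

Lemma sqrt9 u : Num.sqrt (9 - u ^+ 2) = 3 * Num.sqrt (1 - (u / 3) ^+ 2).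
Proof.
transitivity (Num.sqrt (3 ^+ 2 * (1 - (u / 3) ^+ 2))).
  by congr Num.sqrt; field.
by rewrite sqrtrM ?sqr_ge0// sqrtr_sqr ger0_norm.
Qed.

Lemma shift_up_ge r u : radius r -> 1 / 3 <= r -> -1 <= u <= 1 ->
  shift (up r u) = up (3 * r - 1) ((u - 2) / 3).
Proof.
move=> rr r3 u1; rewrite shift_up// sqrt9 ger0_norm; last lra.
by rewrite /up; congr pair; field.
Qed.

Lemma shift_up_le r u : radius r -> r <= 1 / 3 -> -1 <= u <= 1 ->
  shift (up r u) = up (1 - 3 * r) ((2 - u) / 3).
Proof.
move=> rr r3 u1; rewrite shift_up// sqrt9 ler0_norm; last lra.
rewrite /up [((2 - u) / 3) ^+ 2](_ : _ = ((u - 2) / 3) ^+ 2); last by field.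
by congr pair; field.
Qed.

Lemma shift_low r v : radius r -> -1 <= v <= 1 -> shift (low r v) = up r (- v / 3).
Proof.
move=> rr v1; have y0 := low_le0 v rr; have r6 := radius_bounds rr.
have x3 : 2 / 3 <= (low r v).1 by rewrite /=; nra.
rewrite /shift pos_right// rad_le0// min_l// ger0_norm; last lra.
congr pair => /=; first by field.
rewrite subrr mul0r mul0r addr0 (_ : (1 + 1) / 2 = 1) ?mul1r; last by field.
transitivity (Num.sqrt (r ^+ 2 * (1 - (- v / 3) ^+ 2))); last first.
  by rewrite sqrtrM ?sqr_ge0// sqrtr_sqr ger0_norm//; lra.
congr Num.sqrt.
rewrite exprMn real_normK ?num_real// sqr_sqrtr; last by lra.
by rewrite sqrrN expr_div_n exprMn sqr_sin//; field.
Qed.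

Lemma shift_scale q : 0 <= q.1 <= 1 -> q.2 <= 0 -> shift (scale (1 / 3) q) = q.
Proof.
move=> x01 y0; have y3 : (scale (1 / 3) q).2 <= 0 by rewrite /=; lra.
rewrite /shift pos_left//=; last by lra.
rewrite rad_le0// ler0_norm/=; last by lra.
rewrite min_l/=; last by lra.
rewrite (_ : 9 - (- 1 - 2) ^+ 2 = 0); last by ring.
by rewrite sqrtr0 mulr0 subrr !mul0r; case: q {x01 y0 y3} => x y /=; congr pair; field.
Qed.

Lemma knaster_x p : K p -> 0 <= p.1 <= 1.
Proof.
case/knasterP=> [[r [u [/radius_bounds rr u1 ->]]]|[r [u [/radius_bounds rr u1 ->]]]|] /=.
- by nra.
- by nra.
- by case=> q [_ x1 _ ->] /=; lra.
Qed.

Lemma knaster_y p : K p -> -1 <= p.2 <= 1.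
Proof.
move=> Kp; have [c [a [c1 a1 e]]] : exists c a : R,
    [/\ 0 <= c <= 1, 0 <= a <= 1 & (p.1 - a) ^+ 2 + p.2 ^+ 2 = (c - a) ^+ 2].
  case: Kp => [[c /cantor01 c1 [e _]]|[[//|n] _ [c [/cantor01 c1 _] [e _]]]].
    by exists c, (1 / 2); split=> //; lra.
  exists c, (5 / (2 * 3 ^+ n.+1)); split=> //.
  have w1 : 1 <= 3 ^+ n :> R by rewrite exprn_ege1// ler1n.
  by rewrite divr_ge0//= ?ler_pdivrMr ?mul1r exprS; lra.
rewrite -sqr_le_bounds// expr1n.
have : (c - a) ^+ 2 <= 1 ^+ 2 by rewrite sqr_le_bounds//; lra.
by rewrite -e expr1n; apply: le_trans; rewrite lerDr sqr_ge0.
Qed.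

Lemma radius_triple r : radius r -> radius `|3 * r - 1|.
Proof.
move=> rr; have := radius_bounds rr; case: rr => Cr _ r6.
rewrite -normrN (_ : - (3 * r - 1) = 3 * (1 / 2 - r) - 1 / 2); last by field.
apply: radius_dist; apply: cantor_left => //.
by have := cantor_gap Cr; lra.
Qed.

Lemma radius_near r : radius r -> radius ((r + 1) / 3).
Proof.
move=> rr; have r6 := radius_bounds rr; case: rr => /cantor_third Cr _.
by split; [rewrite (_ : _ - _ = (1 / 2 - r) / 3)//; field|lra].
Qed.

Lemma radius_far r : radius r -> radius ((1 - r) / 3).
Proof.
move=> rr; have r6 := radius_bounds rr; case: rr => /cantor_compl/cantor_third Cr _.
by split; [rewrite (_ : _ - _ = (1 - (1 / 2 - r)) / 3)//; field|lra].
Qed.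

Lemma knaster_shift p : K p -> K (shift p).
Proof.
case/knasterP=> [[r [u [rr u1 ->]]]|[r [u [rr u1 ->]]]|[q [Kq x1 y0 ->]]].
- have := radius_triple rr; have [r3|r3] := leP (1 / 3) r.
    by rewrite shift_up_ge// ger0_norm; [move=> ?; apply: knaster_up => //; lra|lra].
  by rewrite shift_up_le ?(ltW r3)// ltr0_norm ?opprB; [move=> ?; apply: knaster_up => //; lra|lra].
- by rewrite shift_low//; apply: knaster_up => //; lra.
- by rewrite shift_scale.
Qed.

(** The inverse of [shift] on the upper semicircle of radius [r]: its middle
third comes from a lower semicircle, its outer thirds from the two upper
semicircles which that one joins. *)
Definition unshift r u : R * R :=
  if u <= - 1 / 3 then up ((r + 1) / 3) (3 * u + 2)
  else if u < 1 / 3 then low r (- 3 * u)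
  else up ((1 - r) / 3) (2 - 3 * u).

Lemma shift_onto p : K p -> exists2 q, K q & shift q = p.
Proof.
move=> Kp; have [y0|y0] := leP p.2 0.
  exists (scale (1 / 3) p); first exact: knaster_scale.
  by rewrite shift_scale//; exact: knaster_x.
have [|[r [v [rr v1 pE]]]|[q [_ _ q0 pE]]] := knasterP Kp; last first.
- by move: y0; rewrite pE /=; lra.
- by have := low_le0 v rr; rewrite -pE; lra.
move=> [r [u [rr u1 ->]]]; have r6 := radius_bounds rr; exists (unshift r u).
  rewrite /unshift; case: ifPn => [u3|/negP u3].
    by apply: knaster_up; [exact: radius_near|lra].
  case: ifPn => [u3'|/negP u3']; first by apply: knaster_low => //; lra.
  by apply: knaster_up; [exact: radius_far|lra].
rewrite /unshift; case: ifPn => [u3|/negP u3].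
  rewrite shift_up_ge//; [|exact: radius_near|lra|lra].
  by congr up; field.
case: ifPn => [u3'|/negP u3']; first by rewrite shift_low//; [congr up; field|lra].
rewrite shift_up_le//; [|exact: radius_far|lra|lra].
by congr up; field.
Qed.

Lemma up_end r : up r 1 = (1 / 2 + r, 0).
Proof. by rewrite /up expr1n subrr sqrtr0 mulr0 mulr1. Qed.

Lemma up_start r : up r (- 1) = (1 / 2 - r, 0).
Proof. by rewrite /up sqrrN expr1n subrr sqrtr0 mulr0 mulrN1. Qed.

Lemma low_end r : low r 1 = (5 / 6 + r / 3, 0).
Proof. by rewrite /low expr1n subrr sqrtr0 mulr0 mul0r oppr0 mulr1. Qed.

Lemma low_start r : low r (- 1) = (5 / 6 - r / 3, 0).
Proof. by rewrite /low sqrrN expr1n subrr sqrtr0 mulr0 mul0r oppr0 mulrN1 mulNr. Qed.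

Lemma up_flat r u : radius r -> -1 <= u <= 1 -> (up r u).2 <= 0 -> u = -1 \/ u = 1.
Proof.
move=> [_ r0] u1 /=; rewrite pmulr_rle0// => s0.
have /eqP : Num.sqrt (1 - u ^+ 2) = 0 by have := sqrtr_ge0 (1 - u ^+ 2); lra.
rewrite sqrtr_eq0 subr_le0 => {}u2.
have : (u - 1) * (u + 1) = 0 by nra.
by move/eqP; rewrite mulf_eq0 => /orP[]/eqP; lra.
Qed.

(** Injectivity of [shift]. Where two thirds meet, a point has two descriptions
and both branches of [unshift] give it. *)
Lemma unshiftP p r u : K p -> radius r -> -1 <= u <= 1 -> shift p = up r u ->
  p = unshift r u.
Proof.
move=> + rr u1.
case/knasterP=> [[r' [u' [rr' u1' ->]]]|[r' [v [rr' v1 ->]]]|[q [Kq x1 y0 ->]]].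
- have := radius_triple rr'; have [r3|r3] := leP (1 / 3) r'.
    rewrite shift_up_ge// ger0_norm; last by lra.
    move=> R3 /(up_inj R3)[]//; first by lra.
    move=> <- <-; rewrite /unshift ifT; last by lra.
    by congr up; field.
  rewrite shift_up_le ?(ltW r3)// ltr0_norm ?opprB; last by lra.
  move=> R3 /(up_inj R3)[]//; first by lra.
  move=> <- <-; rewrite /unshift !ifF; try by apply/negP; lra.
  by congr up; field.
- rewrite shift_low// => /(up_inj rr')[]//; first by lra.
  move=> <- <-; rewrite /unshift; case: ifPn => [v3|/negP v3].
    rewrite (_ : v = 1); last by lra.
    rewrite (_ : 3 * _ + 2 = 1); last by field.
    by rewrite low_end up_end; congr pair; field.
  case: ifPn => [v3'|/negP v3'].
    by congr low; field.
  rewrite (_ : v = -1); last by lra.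
  rewrite (_ : 2 - _ = 1); last by field.
  by rewrite low_start up_end; congr pair; field.
- rewrite shift_scale// => qE; move: y0; rewrite qE => /(up_flat rr u1)[] ->.
    rewrite /unshift ifT; last by lra.
    rewrite (_ : 3 * -1 + 2 = -1); last by field.
    by rewrite !up_start /scale /=; congr pair; field.
  rewrite /unshift !ifF; try by apply/negP; lra.
  rewrite (_ : 2 - 3 * 1 = -1); last by field.
  by rewrite up_start up_end /scale /=; congr pair; field.
Qed.

Lemma shift_le0 p : K p -> (shift p).2 <= 0 -> p.2 <= 0 /\ p = scale (1 / 3) (shift p).
Proof.
case/knasterP=> [[r [u [rr u1 ->]]]|[r [v [rr v1 ->]]]|[q [Kq x1 y0 ->]]].
- have := radius_triple rr; have [r3|r3] := leP (1 / 3) r.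
    rewrite shift_up_ge// ger0_norm; last by lra.
    move=> R3 /(up_flat R3)[|u3|u3]; [lra| |exfalso; lra].
    have -> : u = -1 by lra.
    by rewrite (_ : (-1 - 2) / 3 = -1) ?up_start /scale /=; [split=> //; congr pair; field|field].
  rewrite shift_up_le ?(ltW r3)// ltr0_norm ?opprB; last by lra.
  move=> R3 /(up_flat R3)[|u3|u3]; [lra|exfalso; lra|].
  have -> : u = -1 by lra.
  by rewrite (_ : (2 - -1) / 3 = 1) ?up_start ?up_end /scale /=; [split=> //; congr pair; field|field].
- by rewrite shift_low// => /(up_flat rr)[|u3|u3]; [lra|exfalso; lra|exfalso; lra].
- by rewrite shift_scale//=; split=> //; lra.
Qed.

(** Points of a fibre of [pos] either lie at the same angle on two upper
semicircles or are both on or below the axis, at any positions. Measuring the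
first case by radii, not by distance, makes the relation shrink exactly by the
factor 3 under the inverse of the shift. *)
Definition close (d : R) p q :=
  (exists r r' u, [/\ radius r, radius r', -1 <= u <= 1, p = up r u & q = up r' u] /\
     `|r - r'| <= d) \/
  [/\ p.2 <= 0, q.2 <= 0, `|p.1 - q.1| <= d & `|p.2 - q.2| <= d].

Lemma close_shift d p q : K p -> K q -> close d (shift p) (shift q) ->
  close (d / 3) p q.
Proof.
move=> Kp Kq [[r [r' [u [[rr rr' u1 pE qE] rd]]]]|[p0 q0 x1 y1]].
  rewrite (unshiftP Kp rr u1 pE) (unshiftP Kq rr' u1 qE) /unshift.
  move: rd; rewrite ler_norml => rd; case: ifPn => [u3|/negP u3].
    left; exists ((r + 1) / 3), ((r' + 1) / 3), (3 * u + 2); split; last first.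
      by rewrite ler_norml; lra.
    by split=> //; [exact: radius_near|exact: radius_near|lra].
  case: ifPn => [u3'|/negP u3'].
    have bnd b : `|b| <= 1 / 3 -> `|(r' - r) * b| <= d / 3.
      move=> b1; rewrite normrM (_ : d / 3 = d * (1 / 3)); last by field.
      by apply: ler_pM => //; rewrite ler_norml; lra.
    right; split; [exact: low_le0|exact: low_le0| |] => /=.
      have -> : 5 / 6 + r * (-3 * u) / 3 - (5 / 6 + r' * (-3 * u) / 3) = (r' - r) * u by field.
      by apply: bnd; rewrite ler_norml; lra.
    set s := Num.sqrt _; have s1 : s <= 1 := sin_le1 _.
    have s0 : 0 <= s := sqrtr_ge0 _.
    have -> : - (r * s / 3) - - (r' * s / 3) = (r' - r) * (s / 3) by field.
    by apply: bnd; rewrite ler_norml; lra.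
  left; exists ((1 - r) / 3), ((1 - r') / 3), (2 - 3 * u); split; last first.
    by rewrite ler_norml; lra.
  by split=> //; [exact: radius_far|exact: radius_far|lra].
have [p0' pE] := shift_le0 Kp p0; have [q0' qE] := shift_le0 Kq q0.
move: x1 y1 pE qE; move: (shift p) (shift q) => s t; rewrite !ler_norml => x1 y1 pE qE.
by right; split=> //; rewrite pE qE ler_norml /=; lra.
Qed.

Lemma pos_le0 p : K p -> p.2 <= 0 -> pos p = -1 \/ pos p = 1.
Proof.
case/knasterP=> [[r [u [rr u1 ->]]]|[r [v [rr v1 ->]]]|[q [Kq x1 y0 ->]]] p0.
- by rewrite pos_up//; exact: (up_flat rr).
- right; apply: pos_right => //=; have := radius_bounds rr; nra.
- by left; apply: pos_left => //=; lra.
Qed.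

Lemma close_pos p q : K p -> K q -> pos p = pos q -> close 1 p q.
Proof.
have H p' q' : K p' -> K q' -> p'.2 <= 0 -> pos p' = pos q' -> close 1 p' q'.
  move=> Kp Kq p0 e; right; have := knaster_x Kp; have := knaster_x Kq.
  have := knaster_y Kp; have := knaster_y Kq.
  have q0 : q'.2 <= 0.
    have [//|q0] := leP q'.2 0.
    have [[r [u [rr u1 qE]]]|[r [v [rr v1 qE]]]|[q1 [_ _ y0 qE]]] := knasterP Kq.
    - rewrite qE pos_up// in e; have := pos_le0 Kp p0.
      rewrite e => uE; move: q0; rewrite qE.
      by case: uE => ->; rewrite ?up_start ?up_end /=; lra.
    - by have := low_le0 v rr; rewrite -qE; lra.
    - by move: q0; rewrite qE /=; lra.
  by split=> //; rewrite ler_norml; lra.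
have close_sym d p' q' : close d p' q' -> close d q' p'.
  case=> [[r [r' [u [[rr rr' u1 pE qE] rd]]]]|[p0 q0 x1 y1]]; last first.
    by right; split=> //; rewrite distrC.
  by left; exists r', r, u; rewrite distrC.
move=> Kp Kq e; have [p0|p0] := leP p.2 0; first exact: H.
have [q0|q0] := leP q.2 0; first by apply: close_sym; exact: H.
have gen p' : K p' -> 0 < p'.2 -> exists r u, [/\ radius r, -1 <= u <= 1 & p' = up r u].
  case/knasterP=> [//|[r [v [rr v1 ->]]]|[q1 [_ _ y0 ->]]] /=.
    by move=> /lt_geF; rewrite (low_le0 v rr).
  by lra.
have [r [u [rr u1 pE]]] := gen p Kp p0; have [r' [u' [rr' u1' qE]]] := gen q Kq q0.
left; exists r, r', u; rewrite pE qE !pos_up// in e; rewrite pE qE e.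
split; first by [].
rewrite ler_norml; have := radius_bounds rr; have := radius_bounds rr'; lra.
Qed.

Lemma close_dist d p q : close d p q -> `|p - q| <= d.
Proof.
rewrite prod_normE ge_max /=.
case=> [[r [r' [u [[rr rr' u1 -> ->] rd]]]]|[p0 q0 x1 y1]]; last by rewrite x1.
move: rd; rewrite !ler_norml/= => rd.
have -> : 1 / 2 + r * u - (1 / 2 + r' * u) = (r - r') * u by ring.
have s1 := sin_le1 u; have s0 := sqrtr_ge0 (1 - u ^+ 2).
by rewrite -mulrBl; nra.
Qed.

(** The coordinates of the inverse limit, up to a reparametrization that
collapses the lower semicircles. *)
Definition coord n p : R := pos (iter n shift p).

(** Each application of the inverse of [shift] divides the size of a fibre by
3, so the coordinates become fine enough to define chains of small mesh. *)
Lemma coord_fiber n p q : K p -> K q -> coord n p = coord n q ->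
  `|p - q| <= 1 / 3 ^+ n.
Proof.
move=> Kp Kq e; apply: close_dist; elim: n p q Kp Kq e => [|n IH] p q Kp Kq.
  by rewrite expr0 divr1; exact: close_pos.
rewrite /coord !iterSr => e; rewrite exprSr invfM mulrA.
by apply: close_shift => //; apply: IH => //; exact: knaster_shift.
Qed.

Lemma coord_onto n u : -1 <= u <= 1 -> exists2 p, K p & coord n p = u.
Proof.
move=> u1; elim: n => [|n [p Kp <-]].
  have r2 : radius (1 / 2 : R) by split; [rewrite subrr; exact: cantor0|lra].
  by exists (up (1 / 2) u); [exact: knaster_up|rewrite /coord pos_up].
have [q Kq qE] := shift_onto Kp.
by exists q => //; rewrite /coord iterSr qE.
Qed.

Lemma pos_bounds p : K p -> -1 <= pos p <= 1.
Proof.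
move=> Kp; have [y0|y0] := leP p.2 0.
  by case: (pos_le0 Kp y0) => ->; lra.
have [[r [u [rr u1 ->]]]|[r [v [rr v1 pE]]]|[q [Kq x1 q0 pE]]] := knasterP Kp.
- by rewrite pos_up.
- by have := low_le0 v rr; rewrite -pE; lra.
- by move: y0; rewrite pE /=; lra.
Qed.

Lemma knaster_iter n p : K p -> K (iter n shift p).
Proof. by move=> Kp; elim: n => [//|n IH]; rewrite iterS; exact: knaster_shift. Qed.

Lemma coord_bounds n p : K p -> -1 <= coord n p <= 1.
Proof. by move=> Kp; apply/pos_bounds/knaster_iter. Qed.

End Shift.

(** * Continuity and compactness *)

Section Continuity.
Context {R : realType}.
Local Open Scope ring_scope.
Implicit Types (f g : R * R -> R).

Lemma contD f g : continuous f -> continuous g -> continuous (fun p => f p + g p).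
Proof. by move=> cf cg p; exact: cvgD (cf p) (cg p). Qed.

Lemma contB f g : continuous f -> continuous g -> continuous (fun p => f p - g p).
Proof. by move=> cf cg p; exact: cvgB (cf p) (cg p). Qed.

Lemma contM f g : continuous f -> continuous g -> continuous (fun p => f p * g p).
Proof. by move=> cf cg p; exact: cvgM (cf p) (cg p). Qed.

Lemma contX f : continuous f -> continuous (fun p => f p ^+ 2).
Proof. by move=> cf p; rewrite /=; exact: cvgM (cf p) (cf p). Qed.

Lemma cont_sqrt f : continuous f -> continuous (fun p => Num.sqrt (f p)).
Proof. by move=> cf p; apply: continuous_comp; [exact: cf|exact: sqrt_continuous]. Qed.

Lemma cont_norm f : continuous f -> continuous (fun p => `|f p|).
Proof. by move=> cf p; exact: cvg_norm (cf p). Qed.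

Lemma cont_max f (a : R) : continuous f -> continuous (fun p => Num.max (f p) a).
Proof.
by move=> cf p; apply: (@continuous_max _ _ f (fun=> a)); [exact: cf|exact: cvg_cst].
Qed.

Lemma cont_min f (a : R) : continuous f -> continuous (fun p => Num.min (f p) a).
Proof.
by move=> cf p; apply: (@continuous_min _ _ f (fun=> a)); [exact: cf|exact: cvg_cst].
Qed.

Lemma cont_cst (a : R) : continuous (fun _ : R * R => a).
Proof. by move=> p; exact: cvg_cst. Qed.

Lemma cont_fst : continuous (fun p : R * R => p.1).
Proof. by move=> p; exact: cvg_fst. Qed.

Lemma cont_snd : continuous (fun p : R * R => p.2).
Proof. by move=> p; exact: cvg_snd. Qed.

Lemma cont_pair f g : continuous f -> continuous g -> continuous (fun p => (f p, g p)).
Proof. by move=> cf cg p; exact: cvg_pair (cf p) (cg p). Qed.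

Lemma continuous_rad : continuous (@rad R).
Proof.
apply: cont_sqrt; apply: contD; apply: contX.
- by apply: contB; [exact: cont_fst|exact: cont_cst].
- by apply: cont_max; exact: cont_snd.
Qed.

Lemma continuous_pos : continuous (@pos R).
Proof.
apply: contM; first by apply: contB; [exact: cont_fst|exact: cont_cst].
move=> p; apply: cvgV; last exact: (cont_max continuous_rad).
by rewrite gt_eqF// lt_max; apply/orP; right; lra.
Qed.

Lemma continuous_shift : continuous (@shift R).
Proof.
have ch : continuous (fun p : R * R =>
    `|rad p - 1 / 3| * Num.sqrt (9 - (pos p - 2) ^+ 2)).
  apply: contM; [apply: cont_norm|apply: cont_sqrt].
    by apply: contB; [exact: continuous_rad|exact: cont_cst].
  by apply: contB; [exact: cont_cst|apply: contX; apply: contB;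
    [exact: continuous_pos|exact: cont_cst]].
have cm : continuous (fun p : R * R => Num.min p.2 0) by apply: cont_min; exact: cont_snd.
apply: cont_pair.
  apply: contD; first exact: cont_cst.
  by apply: contM; apply: contB; [exact: continuous_rad|exact: cont_cst|
    exact: continuous_pos|exact: cont_cst].
apply: contD; apply: contM.
- by apply: contM; [apply: contD; [exact: cont_cst|exact: continuous_pos]|exact: cont_cst].
- by apply: cont_sqrt; apply: contD; [exact: contX|apply: contM; [exact: cont_cst|exact: contX]].
- by apply: contM; [apply: contB; [exact: cont_cst|exact: continuous_pos]|exact: cont_cst].
- by apply: contD => //; apply: contM; [exact: cont_cst|].
Qed.

Lemma continuous_coord n : continuous (@coord R n).
Proof.
rewrite /coord; elim: n => [|n IH]; first exact: continuous_pos.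
have -> : (fun p : R * R => pos (iter n.+1 shift p)) = (fun p => pos (iter n shift p)) \o @shift R.
  by apply/funext => p; rewrite iterSr.
by move=> p; apply: continuous_comp; [exact: continuous_shift|exact: IH].
Qed.

Lemma continuous_up : continuous (fun p : R * R => up p.1 p.2).
Proof.
apply: cont_pair; first apply: contD; [exact: cont_cst|apply: contM; [exact: cont_fst|exact: cont_snd]|].
apply: contM; [exact: cont_fst|apply: cont_sqrt].
by apply: contB; [exact: cont_cst|apply: contX; exact: cont_snd].
Qed.

Lemma continuous_low : continuous (fun p : R * R => low p.1 p.2).
Proof.
apply: cont_pair.
  apply: contD; first exact: cont_cst.
  by apply: contM; [apply: contM; [exact: cont_fst|exact: cont_snd]|exact: cont_cst].
move=> p; apply: cvgN; move: p; apply: contM; last exact: cont_cst.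
apply: contM; [exact: cont_fst|apply: cont_sqrt].
by apply: contB; [exact: cont_cst|apply: contX; exact: cont_snd].
Qed.

Lemma continuous_scale (a : R) : continuous (scale a).
Proof.
rewrite /scale; apply: cont_pair; apply: contM; try exact: cont_cst.
- exact: cont_fst.
- exact: cont_snd.
Qed.

Lemma closed_halfplane : closed [set p : R * R | p.2 <= 0].
Proof.
apply: (@preimage_closed _ _ (@snd R R) [set y | y <= 0]); last exact: closed_le.
by move=> p _; exact: cont_snd.
Qed.

Lemma compact_radius : compact [set r : R | radius r].
Proof.
have -> : [set r : R | radius r] =
    (fun c : R => 1 / 2 - c) @` (@ternary_cantor R `&` [set c | c <= 1 / 3]).
  apply/seteqP; split=> [r rr /=|_ [c [Cc /= c3] <-]].
    by exists (1 / 2 - r); [split; [exact: rr.1|have := radius_bounds rr; rewrite /=; lra]|lra].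
  by split; [rewrite (_ : _ - _ = c)//; lra|lra].
apply: continuous_compact.
  apply: continuous_subspaceT => c; apply: cvgB; [exact: cvg_cst|exact: cvg_id].
apply: compact_closedI; last exact: closed_le.

apply: (@subclosed_compact R _ `[0, 1]%classic); [exact: closed_cantor|exact: segment_compact|].
by move=> c /cantor01; rewrite /= in_itv.
Qed.

(** The lower semicircles accumulate at the origin, so compactness is not
visible from their union. Unfolding the self-similarity [n] times, with a box in
place of the rest, gives compact sets with intersection the continuum: a point
that stays in a shrunk copy for all [n] is the origin. *)
Fixpoint knaster_stage (n : nat) : set (R * R) :=
  if n is n'.+1 then
    (fun p => up p.1 p.2) @` ([set r | radius r] `*` `[-1, 1]%classic) `|`
    (fun p => low p.1 p.2) @` ([set r | radius r] `*` `[-1, 1]%classic) `|`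
    scale (1 / 3) @` (knaster_stage n' `&` [set p | p.2 <= 0])
  else `[0, 1]%classic `*` `[-1, 1]%classic.

Lemma compact_stage n : compact (knaster_stage n).
Proof.
elim: n => [|n IH] /=; first by apply: compact_setX; exact: segment_compact.
have cr : compact ([set r : R | radius r] `*` (`[-1, 1]%classic : set R)).
  by apply: compact_setX; [exact: compact_radius|exact: segment_compact].
apply: compactU; first apply: compactU.
- by apply: continuous_compact => //; apply: continuous_subspaceT; exact: continuous_up.
- by apply: continuous_compact => //; apply: continuous_subspaceT; exact: continuous_low.
- apply: continuous_compact; first by apply: continuous_subspaceT; exact: continuous_scale.
  by apply: compact_closedI => //; exact: closed_halfplane.
Qed.

Lemma knaster_stageE : @knaster R = \bigcap_n knaster_stage n.
Proof.
apply/seteqP; split=> [p Kp n _|p Sp].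
  elim: n p Kp => [|n IH] p Kp /=.
    by have := knaster_x Kp; have := knaster_y Kp; split; rewrite /= in_itv /=.
  case: (knasterP Kp) => [[r [u [rr u1 ->]]]|[r [u [rr u1 ->]]]|[q [Kq _ q0 ->]]].
  - by left; left; exists (r, u) => //; split=> //=; rewrite in_itv.
  - by left; right; exists (r, u) => //; split=> //=; rewrite in_itv.
  - by right; exists q => //; split=> //; exact: IH.
have K0 : @knaster R (0, 0).
  rewrite (_ : (0, 0) = up (1 / 2) (-1)); last by rewrite up_start subrr.
  by apply: knaster_up; [split; [rewrite subrr; exact: cantor0|lra]|lra].
have step (q : R * R) : (forall n, knaster_stage n q) -> @knaster R q \/
    [/\ forall n, knaster_stage n (scale 3 q), q.2 <= 0 & q = scale (1 / 3) (scale 3 q)].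
  move=> Sq; case: (Sq 1%N) => [[[[r u] /= [rr u1] <-]|[[r u] /= [rr u1] <-]]|].
  - by left; apply: knaster_up => //; move: u1; rewrite /= in_itv.
  - by left; apply: knaster_low => //; move: u1; rewrite /= in_itv.
  move=> _; have [Kq|nK] := pselect (@knaster R q); [by left|right].
  have H n : [/\ knaster_stage n (scale 3 q) & q.2 <= 0].
    case: (Sq n.+1) => [[[[r u] /= [rr u1] e]|[[r u] /= [rr u1] e]]|].
    - by exfalso; apply: nK; rewrite -e; apply: knaster_up => //; move: u1; rewrite /= in_itv.
    - by exfalso; apply: nK; rewrite -e; apply: knaster_low => //; move: u1; rewrite /= in_itv.
    move=> [t [St /= t0] <-]; split=> /=; last by lra.
    by rewrite (_ : scale 3 _ = t)//; case: (t) => a b; rewrite /scale /=; congr pair; field.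
  split; [by move=> n; case: (H n)|by case: (H 0%N)|].
  by case: (q) => a b; rewrite /scale /=; congr pair; field.
have [->//|p0] := eqVneq p (0, 0).
have [k pk] : exists k, 2 < 3 ^+ k * (`|p.1| + `|p.2|).
  have p1 : 0 < `|p.1| + `|p.2|.
    rewrite lt_neqAle addr_ge0// andbT eq_sym paddr_eq0// !normr_eq0.
    by apply: contra_neqN p0 => /andP[/eqP x0 /eqP y0]; rewrite [p]surjective_pairing x0 y0.
  have /archi_boundP kp : 0 <= 2 / (`|p.1| + `|p.2|) by rewrite divr_ge0.
  exists (Num.bound (2 / (`|p.1| + `|p.2|))); rewrite -ltr_pdivrMr//.
  by apply: (lt_le_trans kp); rewrite -natrX ler_nat ltnW// ltn_expl.
(* Enlarging [p] by the factor 3 leads out of the box after finitely many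
   steps, so the unfolding reaches a semicircle before. *)
elim: k p Sp {p0} pk => [|k IH] p Sp pk.
  exfalso; move: pk; rewrite expr0 mul1r ltNge => /negP; apply.
  have [/=] := Sp 0%N I; rewrite /= !in_itv/= => x1 y1.
  have : `|p.1| <= 1 by rewrite ler_norml; lra.
  have : `|p.2| <= 1 by rewrite ler_norml; lra.
  by lra.
have [//|[S3 q0 pE]] := step p (fun n => Sp n I).
rewrite pE; apply: knaster_scale => /=; last by lra.
apply: IH => [n _//|/=]; rewrite !normrM ger0_norm// -mulrDr mulrA.
by rewrite -exprSr.
Qed.

Lemma compact_knaster : compact (@knaster R).
Proof.
rewrite knaster_stageE; apply: (@subclosed_compact _ _ (knaster_stage 0)).
- apply: closed_bigI => n _; apply: compact_closed; last exact: compact_stage.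
  exact: norm_hausdorff.
- exact: compact_stage.
- by move=> p /(_ 0%N I).
Qed.

End Continuity.

(** * Chains from real functions *)

Section ChainsFromFunctions.
Context {R : realType} {V : normedModType R}.
Local Open Scope ring_scope.
Implicit Types (X : set V) (h : V -> R).

(** Otherwise there would be pairs at distance at least [e'] with values
arbitrarily close, and by compactness such a pair with equal values. *)
Lemma compact_fiber_scale X h (e e' : R) : compact X -> continuous h ->
  (forall p q, X p -> X q -> h p = h q -> `|p - q| <= e) -> e < e' ->
  exists2 d, 0 < d &
    forall p q, X p -> X q -> `|h p - h q| < d -> `|p - q| <= e'.
Proof.
move=> cX ch fib ee'.
pose far := (X `*` X) `&` [set z : V * V | e' <= `|z.1 - z.2|].
pose gap (z : V * V) := `|h z.1 - h z.2|.
have cont_gap : continuous gap.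
  move=> z; apply: cvg_norm; apply: cvgB; apply: continuous_comp; try exact: ch.
    exact: cvg_fst.
  exact: cvg_snd.
have closed_far : closed [set z : V * V | e' <= `|z.1 - z.2|].
  apply: (@preimage_closed _ _ (fun z : V * V => `|z.1 - z.2|) [set y | e' <= y]).
    by move=> z _; apply: cvg_norm; apply: cvgB; [exact: cvg_fst|exact: cvg_snd].
  exact: closed_ge.
have : closed (gap @` far).
  apply: compact_closed; first exact: Rhausdorff.
  apply: continuous_compact; first exact: continuous_subspaceT.
  by apply: compact_closedI => //; exact: compact_setX.
move/closed_openC => oF.
have : nbhs (0 : R) (~` (gap @` far)).
  apply: open_nbhs_nbhs; split=> //= -[[p q] [[/= Xp Xq] pq]].
  move/eqP; rewrite normr_eq0 subr_eq0 => /eqP /(fib p q Xp Xq) pqe.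
  by have := lt_le_trans ee' (le_trans pq pqe); rewrite ltxx.
move/nbhs_ballP => [d /= d0 dB]; exists d => // p q Xp Xq hpq.
rewrite leNgt; apply/negP => pq; apply: (dB (gap (p, q))).
  by rewrite /ball/= sub0r normrN normr_id.
by exists (p, q) => //; split=> //=; exact: ltW.
Qed.

Section IntervalChain.
Context (X : set V) (h : V -> R) (N : nat) (N0 : (0 < N)%N).
Context (h_bounds : forall p, X p -> -1 <= h p <= 1).
Context (h_onto : forall u, -1 <= u <= 1 -> exists2 p, X p & h p = u).

(* The range of [h] is rescaled to the interval from 0 to [N], with one link
   around each integer. *)
Let g p := (h p + 1) * (N%:R / 2).

Definition interval_chain : seq (set V) :=
  mkseq (fun i => X `&` [set p | `|g p - i%:R| < 1]) N.+1.

Lemma link_interval i : (i < N.+1)%N ->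
  link interval_chain i = X `&` [set p | `|g p - i%:R| < 1].
Proof. by move=> iN; rewrite /link nth_mkseq. Qed.

Let N0R : 0 < N%:R :> R. Proof. by rewrite ltr0n. Qed.

Let g_bounds p : X p -> 0 <= g p <= N%:R.
Proof. by move=> /h_bounds; rewrite /g; move: N0R; nra. Qed.

Let g_onto t : 0 <= t <= N%:R -> exists2 p, X p & g p = t.
Proof.
move=> tN; have [|p Xp hp] := @h_onto (t / N%:R * 2 - 1).
  have : 0 <= t / N%:R <= 1.
    by rewrite divr_ge0//= ?ler_pdivrMr//; lra.
  by lra.
by exists p => //; rewrite /g hp; field; rewrite gt_eqF.
Qed.

Lemma size_interval_chain : size interval_chain = N.+1.
Proof. by rewrite size_mkseq. Qed.

Lemma interval_chainP : continuous h -> is_chain X interval_chain.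
Proof.
move=> ch; rewrite /is_chain size_interval_chain; split=> [i iN|i j iN jN].
  rewrite link_interval//; exists [set p | `|g p - i%:R| < 1] => //.
  apply: (@open_comp _ _ (fun p => `|g p - i%:R|) [set y | y < 1]); last exact: open_lt.
  move=> p _; apply: cvg_norm; apply: cvgB; last exact: cvg_cst.
  apply: cvgM; last exact: cvg_cst.
  by apply: cvgD; [exact: ch|exact: cvg_cst].
rewrite !link_interval//; split.
  move=> [p [[_ /= pi] [_ /= pj]]]; move: pi pj; rewrite !ltr_norml => pi pj.
  by split; rewrite -ltnS -(ltr_nat R) -!natr1; lra.
move=> [ij ji]; have [|p Xp gp] := @g_onto ((i%:R + j%:R) / 2).
  by move: iN jN; rewrite !ltnS -!(ler_nat R); have := ler0n R i; have := ler0n R j; lra.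
move: ij ji; rewrite -!(ler_nat R) -!natr1 => ij ji.
by exists p; split; split=> //=; rewrite gp ltr_norml; lra.
Qed.

Let g_index p : X p -> exists2 i, (i < N.+1)%N & i%:R <= g p < i%:R + 1.
Proof.
move=> Xp; have /andP[gp0 gpN] := g_bounds Xp; have gpi := truncn_itv gp0.
exists (Num.truncn (g p)); last by rewrite natr1.
by rewrite -(ltr_nat R); move: gpi gpN; rewrite -!natr1; lra.
Qed.

Lemma interval_chain_covers : covers X interval_chain.
Proof.
move=> p Xp; have [i iN ip] := g_index Xp; exists i; first by rewrite size_interval_chain.
by rewrite link_interval//; split=> //=; rewrite ltr_norml; lra.
Qed.

Lemma interval_chain_le p q : X p -> X q -> h p <= h q -> chain_le interval_chain p q.
Proof.
move=> Xp Xq hpq; have gpq : g p <= g q by rewrite /g ler_pM2r ?divr_gt0// lerD2r.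
have [i iN ip] := g_index Xp; have [j jN jq] := g_index Xq.
exists i, j; split; rewrite ?size_interval_chain ?link_interval//.
- by rewrite -ltnS -(ltr_nat R) -natr1; lra.
- by split=> //=; rewrite ltr_norml; lra.
- by split=> //=; rewrite ltr_norml; lra.
Qed.

Lemma interval_chain_lt p q : chain_le interval_chain p q -> h p < h q + 4 / N%:R.
Proof.
move=> [i [j [ij]]]; rewrite size_interval_chain => jN.
rewrite !link_interval ?(leq_ltn_trans ij)// => -[_ /= pi] [_ /= qj].
move: ij pi qj; rewrite -(ler_nat R) !ltr_norml => ij pi qj.
have gpq : g p < g q + 2 by lra.
have M0 : 0 < N%:R / 2 :> R by rewrite divr_gt0.
have gpq' : (h p - h q) * (N%:R / 2) < 2 by move: gpq; rewrite /g; lra.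
rewrite -ltrBlDl (_ : 4 / _ = 2 / (N%:R / 2)); last by field; rewrite gt_eqF.
by rewrite ltr_pdivlMr.
Qed.

Lemma interval_chain_mesh (e d : R) : 0 <= e -> 4 / N%:R <= d ->
  (forall p q, X p -> X q -> `|h p - h q| < d -> `|p - q| <= e) ->
  (mesh interval_chain <= e%:E)%E.
Proof.
move=> e0 Nd fib; rewrite /mesh /interval_chain big_map.
apply: bigmax_le; first by rewrite lee_fin.
move=> i _; apply: ub_ereal_sup => _ [[p q] [[Xp /= pi] [Xq /= qi]] <-].
rewrite lee_fin; apply: fib => //; apply: lt_le_trans Nd.
rewrite !ltr_norml in pi qi.
rewrite (_ : 4 / _ = 2 / (N%:R / 2)); last by field; rewrite gt_eqF.
have M0 : 0 < N%:R / 2 :> R by rewrite divr_gt0.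
have gE : g p - g q = (h p - h q) * (N%:R / 2) by rewrite /g; ring.
rewrite ltr_pdivlMr// -(gtr0_norm M0) -normrM -gE ltr_norml.
by lra.
Qed.

End IntervalChain.

(** The links are the preimages under [h] of overlapping intervals; by
compactness, short intervals have preimages hardly larger than the fibres of
[h]. Any positive constant could replace [2 / 3], which is the distance between
the two sides of the itineraries below. *)
Lemma chain_of_function X h (e e' : R) : compact X -> continuous h ->
  (forall p, X p -> -1 <= h p <= 1) ->
  (forall u, -1 <= u <= 1 -> exists2 p, X p & h p = u) ->
  (forall p q, X p -> X q -> h p = h q -> `|p - q| <= e) -> 0 <= e' -> e < e' ->
  exists D, [/\ is_chain X D, covers X D, (mesh D <= e'%:E)%E,
    forall p q, X p -> X q -> h p <= h q -> chain_le D p q &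
    forall p q, h q + 2 / 3 <= h p -> ~ chain_le D p q].
Proof.
move=> cX ch hb ho fib e0 ee'; have [d d0 dP] := compact_fiber_scale cX ch fib ee'.
have [N [N6 Nd]] : exists N, 6 <= N%:R :> R /\ 4 / d <= N%:R.
  exists (maxn (Num.bound (4 / d)) 6); split; first by rewrite (ler_nat R 6) leq_maxr.
  have /archi_boundP/ltW/le_trans : 0 <= 4 / d by rewrite divr_ge0 ?ltW.
  by apply; rewrite ler_nat leq_maxl.
have N0R : 0 < N%:R :> R by lra.
have N0 : (0 < N)%N by rewrite -(ltr_nat R).
have {}Nd : 4 / N%:R <= d by rewrite ler_pdivrMr// mulrC -ler_pdivrMr.
exists (interval_chain X h N); split.
- exact: interval_chainP.
- exact: interval_chain_covers.
- exact: interval_chain_mesh dP.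
- exact: interval_chain_le.
- move=> p q hqp /(interval_chain_lt N0).
  have : 4 / N%:R <= 2 / 3 :> R by rewrite ler_pdivrMr//; lra.
  by lra.
Qed.

End ChainsFromFunctions.

(** * Prescribed itineraries *)

Section Itineraries.
Context {R : realType}.
Local Open Scope ring_scope.
Implicit Types (A : set nat) (p : R * R).
Local Notation K := (@knaster R).

Definition on_side A n p : Prop :=
  (A n -> coord n.+1 p <= - 1 / 3) /\ (~ A n -> 1 / 3 <= coord n.+1 p).

(** A preimage under [shift] of an upper semicircle can be taken on either of
two upper semicircles, and this choice alone decides the sign of the next
coordinate. *)
Lemma finite_itinerary N A : exists2 r : R, radius r &
  forall u, -1 <= u <= 1 -> forall i, (i < N)%N -> on_side A i (up r u).
Proof.
elim: N A => [|N IH] A.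
  exists (1 / 2) => //; split; [rewrite subrr; exact: cantor0|lra].
have [r rr rP] := IH [set n | A n.+1]; have r6 := radius_bounds rr.
have [A0|A0] := pselect (A 0%N).
- exists ((r + 1) / 3); first exact: radius_near.
  move=> u u1; have sE : shift (up ((r + 1) / 3) u) = up r ((u - 2) / 3).
    by rewrite shift_up_ge; [congr up; field|exact: radius_near|lra|].
  case=> [_|i iN]; rewrite /on_side /coord iterSr sE.
    by split=> // _; rewrite /= pos_up//; lra.
  by apply: rP => //; lra.
- exists ((1 - r) / 3); first exact: radius_far.
  move=> u u1; have sE : shift (up ((1 - r) / 3) u) = up r ((2 - u) / 3).
    by rewrite shift_up_le; [congr up; field|exact: radius_far|lra|].
  case=> [_|i iN]; rewrite /on_side /coord iterSr sE.
    by split=> // _; rewrite /= pos_up//; lra.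
  by apply: rP => //; lra.
Qed.

Lemma closed_on_side A n : closed [set p | on_side A n p].
Proof.
have [An|An] := pselect (A n).
  rewrite (_ : mkset _ = (@coord R n.+1) @^-1` [set y | y <= - 1 / 3]).
    by apply: preimage_closed; [move=> p _; exact: continuous_coord|exact: closed_le].
  by apply/seteqP; split=> p /=; [case=> + _; exact|split].
rewrite (_ : mkset _ = (@coord R n.+1) @^-1` [set y | 1 / 3 <= y]).
  by apply: preimage_closed; [move=> p _; exact: continuous_coord|exact: closed_ge].
by apply/seteqP; split=> p /=; [case=> _; exact|split].
Qed.

(** Being on the prescribed side is a closed condition, so a cluster point of
points with longer and longer prescribed itineraries has the whole one. *)
Lemma itinerary A : exists2 p, K p & forall n, on_side A n p.
Proof.
have /choice[s sP] N : exists p, K p /\ forall i, (i < N)%N -> on_side A i p.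
  have [r rr rP] := finite_itinerary N A.
  exists (up r 0); split; first by apply: knaster_up => //; lra.
  by apply: rP; lra.
have [|p [Kp clp]] := @compact_knaster R (s n @[n --> \oo]) _.
  by exists 0%N => // n _; exact: (sP n).1.
exists p => // n; apply: closed_on_side => B Bp; apply: clp => //.
by exists n.+1 => // m /= nm; apply: (sP m).2.
Qed.

(** Two points with complementary itineraries. *)
Lemma separated_pair A : exists xy : (R * R) * (R * R), [/\ K xy.1, K xy.2 &
  forall n, (A n -> coord n.+1 xy.1 <= coord n.+1 xy.2) /\
            (~ A n -> coord n.+1 xy.2 + 2 / 3 <= coord n.+1 xy.1)].
Proof.
have [x Kx xP] := itinerary A; have [y Ky yP] := itinerary (~` A).
exists (x, y); split=> // n; have [x1 x2] := xP n; have [y1 y2] := yP n.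
split=> An /=; first by have := x1 An; have := y2 (fun nA => nA An); lra.
by have := x2 An; have := y1 An; lra.
Qed.

(** The [n]-th chain orders points like the coordinate [n.+1], up to an error
smaller than the gap between the two points of a separated pair. Hence one
sequence of chains realizes all comparison patterns. *)
Lemma knaster_chains : exists2 D : nat -> seq (set (R * R)), chain_sequence K D &
  forall A, exists x y, [/\ K x, K y & [set n | chain_le (D n) x y] = A].
Proof.
have /choice[D DP] n : exists D : seq (set (R * R)), [/\ is_chain K D, covers K D,
    (mesh D <= (1 / 3 ^+ n)%:E)%E,
    forall p q, K p -> K q -> coord n.+1 p <= coord n.+1 q -> chain_le D p q &
    forall p q, coord n.+1 q + 2 / 3 <= coord n.+1 p -> ~ chain_le D p q].
  have n0 : 0 < 3 ^+ n :> R by rewrite exprn_gt0.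
  apply: (@chain_of_function _ _ K (@coord R n.+1) (1 / 3 ^+ n.+1)).
  - exact: compact_knaster.
  - exact: continuous_coord.
  - exact: coord_bounds.
  - by move=> u; exact: coord_onto.
  - exact: coord_fiber.
  - by rewrite divr_ge0 ?ltW.
  - by rewrite !mul1r ltf_pV2 ?posrE ?exprn_gt0// ltr_eXn2l// ltr1n.
exists D.
  split=> [n|]; first by case: (DP n).
  apply: (@squeeze_cvge _ _ _ _ (cst 0%E) _ (fun n => (1 / 3 ^+ n)%:E)).
  - apply: nearW => n; case: (DP n) => _ _ -> _ _; rewrite andbT.
    by rewrite /mesh; elim: (D n) => [|d l IH]; rewrite ?big_nil// big_cons le_max IH orbT.
  - exact: cvg_cst.
  - apply: cvg_EFin; first exact: nearW.
    rewrite (_ : _ \o _ = geometric 1 (1 / 3)); last first.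
      by apply/funext => n; rewrite /= !mul1r exprVn.
    by apply: cvg_geometric; rewrite ger0_norm; lra.
move=> A; have [[x y] [/= Kx Ky xyP]] := separated_pair A.
exists x, y; split=> //; apply/seteqP; split=> n /=; case: (DP n) => _ _ _ le1 le2.
  by move=> xyn; apply: contrapT => An; exact: le2 ((xyP n).2 An) xyn.
by move=> An; apply: le1 => //; exact: (xyP n).1.
Qed.

End Itineraries.

(** * Ultrafilters on a countable set *)

Section Ultrafilters.
Implicit Types (s t : set nat) (S : set (set nat)).

Definition trace s (m : nat) : seq bool := mkseq (fun i => `[< s i >]) m.

(** Hausdorff's independent family. Finitely many distinct sets have distinct
traces from some length on, so that a suitable set of words [G] realizes any
finite pattern of membership. *)
Definition indep s : set nat :=
  [set k | if @unpickle (nat * seq (seq bool))%type k is Some (m, G)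
           then trace s m \in G else false].

Lemma indep_pickle s m (G : seq (seq bool)) :
  indep s (pickle (m, G)) = (trace s m \in G).
Proof. by rewrite /indep /= pickleK. Qed.

Lemma trace_separates (l : seq (set nat)) : exists m0, forall m, (m0 <= m)%N ->
  {in l &, forall s t, trace s m = trace t m -> s = t}.
Proof.
have pair s t : exists m0, forall m, (m0 <= m)%N -> trace s m = trace t m -> s = t.
  have [->|] := pselect (s = t); first by exists 0.
  move=> st; have [i sti] : exists i, `[< s i >] != `[< t i >].
    apply: contrapT => /forallNP e; apply: st; apply/funext => i.
    have /negP/negPn/eqP ei := e i; apply/propext.
    by split=> /asboolP; [rewrite ei|rewrite -ei] => /asboolP.
  exists i.+1 => m im /(congr1 (nth false ^~ i)).
  by rewrite !nth_mkseq// => e; rewrite e eqxx in sti.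
have /choice[f fP] (z : set nat * set nat) : exists m0, forall m, (m0 <= m)%N ->
  trace z.1 m = trace z.2 m -> z.1 = z.2 by exact: pair.
exists (\max_(s <- l) \max_(t <- l) f (s, t)) => m lm s t sl tl.
apply: (fP (s, t)); apply: leq_trans lm.
apply: (bigmaxn_sup_seq s) => //.
exact: (leq_bigmax_seq t).
Qed.

Lemma inj_unbounded (f : nat -> nat) N : injective f -> exists m, (N <= f m)%N.
Proof.
move=> fi; apply: contrapT => /forallNP fN.
have : (size (map f (iota 0 N.+1)) <= size (iota 0 N))%N.
  apply: uniq_leq_size; first by rewrite map_inj_uniq ?iota_uniq.
  by move=> _ /mapP[m _ ->]; rewrite mem_iota ltnNge; exact/negP/fN.
by rewrite size_map !size_iota ltnn.
Qed.

Definition chosen S s : set nat := if `[< S s >] then indep s else ~` indep s.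

(** The bound [N] makes the pattern occur infinitely often, hence compatible
with the cofinite sets. *)
Lemma chosen_fip S (l : seq (set nat)) N :
  exists2 k, (N <= k)%N & forall s, s \in l -> chosen S s k.
Proof.
have [m0 mP] := trace_separates l.
pose G m := [seq trace s m | s <- l & `[< S s >]].
have [|m Nm] := @inj_unbounded (fun i => pickle ((m0 + i)%N, G (m0 + i)%N)) N.
  by move=> i j /(pcan_inj pickleK) [/addnI].
exists (pickle ((m0 + m)%N, G (m0 + m)%N)) => // s sl.
rewrite /chosen; case: ifPn => Ss; rewrite ?/setC /mkset indep_pickle.
  by apply: map_f; rewrite mem_filter Ss.
move=> /mapP[t]; rewrite mem_filter => /andP[St tl] e.
by move: Ss; rewrite (mP _ (leq_addr _ _) _ _ sl tl e) St.
Qed.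

Definition base S : set_system nat := [set B | exists (l : seq (set nat)) N,
  forall k, (N <= k)%N -> (forall s, s \in l -> chosen S s k) -> B k].

Lemma base_proper S : ProperFilter (base S).
Proof.
split.
  by move=> [l [N H]]; have [k Nk kP] := chosen_fip S l N; exact: (H k).
split.
- by exists [::], 0%N.
- move=> P Q [l [N HP]] [l' [N' HQ]]; exists (l ++ l'), (maxn N N') => k.
  rewrite geq_max => /andP[Nk Nk'] kP; split.
    by apply: HP => // s sl; apply: kP; rewrite mem_cat sl.
  by apply: HQ => // s sl; apply: kP; rewrite mem_cat sl orbT.
- by move=> P Q PQ [l [N H]]; exists l, N => k Nk kP; apply/PQ/H.
Qed.

(** Pospisil's theorem for a countable set: an independent family of continuum
size has one ultrafilter for each choice of its members. *)
Lemma many_ultrafilters : exists U : set (set nat) -> set_system nat,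
  forall S, nonprincipal_ultrafilter (U S) /\ forall s, S s <-> U S (indep s).
Proof.
have /choice[U UP] S : exists U, UltraFilter U /\ base S `<=` U.
  by have := base_proper S; exact: ultraFilterLemma.
exists U => S; have [uU bU] := UP S; have pU := @ultra_proper _ _ uU.
split; first split=> // t Ut.
  have : U S [set k | (t < k)%N] by apply: bU; exists [::], t.+1.
  by rewrite Ut /principal_filter /= => /(_ t erefl); rewrite /= ltnn.
have ch s : U S (chosen S s).
  by apply: bU; exists [:: s], 0%N => k _; apply; rewrite mem_seq1.
move=> s; have := ch s; rewrite /chosen; case: asboolP => // nS Uns.
split=> // Us; exfalso.
have : U S (indep s `&` ~` indep s) by exact: filterI.
by rewrite setICr; exact: filter_not_empty.
Qed.

End Ultrafilters.

(** * Counting the orders *)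

Section UpperBound.
Context {R : realType}.
Local Open Scope ring_scope.

Lemma rat_cut_inj (a b : R) : (forall q : rat, (ratr q < a) = (ratr q < b)) -> a = b.
Proof.
have H (x y : R) : (forall q : rat, (ratr q < x) = (ratr q < y)) -> ~ x < y.
  move=> e xy; have [q] := rat_in_itvoo xy; rewrite in_itv/= => /andP[xq qy].
  by rewrite -e in qy; have := lt_trans xq qy; rewrite ltxx.
move=> e; have [ab|ba|//] := ltgtP a b; first by have := H _ _ e ab.
by have := H b a (fun q => esym (e q)) ba.
Qed.

(** The Dedekind cuts of the four coordinates. *)
Definition code (z : (R * R) * (R * R)) : set nat :=
  [set k | if @unpickle (nat * rat)%type k is Some (i, q)
           then ratr q < nth 0 [:: z.1.1; z.1.2; z.2.1; z.2.2] i else false].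

Lemma code_inj : injective code.
Proof.
move=> z t zt.
have H i : nth 0 [:: z.1.1; z.1.2; z.2.1; z.2.2] i = nth 0 [:: t.1.1; t.1.2; t.2.1; t.2.2] i.
  apply: rat_cut_inj => q; apply/idP/idP => h.
  - have : code z (pickle (i, q)) by rewrite /code /= pickleK.
    by rewrite zt /code /= pickleK.
  - have : code t (pickle (i, q)) by rewrite /code /= pickleK.
    by rewrite -zt /code /= pickleK.
have := H 0%N; have := H 1%N; have := H 2%N; have := H 3%N.
by case: z t {zt H} => [[a b] [c d]] [[a' b'] [c' d']] /= -> -> -> ->.
Qed.

Lemma plane_relations_card (O : set (set ((R * R) * (R * R)))) :
  O #<= [set: set (set nat)].
Proof.
rewrite (_ : O = (fun T : set (set nat) => code @^-1` T) @` [set T | O (code @^-1` T)]).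
  apply: card_le_trans (card_image_le _ _) _; exact: subset_card_le.
apply/seteqP; split=> [L OL|_ [T OT <-]//].
have LE : code @^-1` (code @` L) = L.
  by apply/seteqP; split=> [z [t Lt /code_inj <-]|z Lz]//; exists z.
by exists (code @` L); rewrite /= LE.
Qed.

End UpperBound.

(* The right-hand side is the double power set of the natural numbers. *)
Theorem theorem6p2 (R : realType) :
  [set L : set ((R * R) * (R * R)) | ultrafilter_order (@knaster R) L]
    #= [set: set (set nat)].
Proof.
apply: Cantor_Bernstein; first exact: plane_relations_card.
have [D DK /choice[x /choice[y xyP]]] := @knaster_chains R.
have [U UP] := many_ultrafilters.
(* The sets in [S] index the members of the independent family that belong to
   the ultrafilter, and the order detects these through the pairs [x], [y]. *)
pose rec (L : set ((R * R) * (R * R))) := [set s | L (x (indep s), y (indep s))].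
have recK S : rec (ultra_le (@knaster R) D (U S)) = S.
  have [_ US] := UP S; apply/seteqP; split=> s; rewrite /rec /ultra_le /=;
    have [Kx Ky xyE] := xyP (indep s); rewrite xyE US; first by case.
  by move=> ?; split.
have -> : [set: set (set nat)] =
    rec @` [set L | ultrafilter_order (@knaster R) L].
  apply/seteqP; split=> // S _; exists (ultra_le (@knaster R) D (U S)) => //.
  by exists D, (U S); split=> //; case: (UP S).
exact: card_image_le.
Qed.
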